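(* Let $R$ be a unital commutative ring, let $t$ be an indeterminate, and let $f(t) = \sum_{M \geq 0} f_M t^M \in R[[t]]$ be an arbitrary formal power series. Let $n \geq 1$ and let $\mathbf{u} = (u_1,\dots,u_n)^T$, $\mathbf{v} = (v_1,\dots,v_n)^T \in R^n$. Then, in $R[[t]]$, \[ n! \, \mathrm{perm}\, f[t \mathbf{u}\mathbf{v}^T] = \sum_{\mathbf{m} \in \mathbb{Z}_{\geq 0}^n} t^{m_1 + \cdots + m_n}\, \mathrm{perm}(\mathbf{u}^{\circ \mathbf{m}})\, \mathrm{perm}(\mathbf{v}^{\circ \mathbf{m}}) \prod_{i=1}^n f_{m_i}. \]
   Context: $f[t\mathbf{u}\mathbf{v}^T]$ denotes the $n \times n$ matrix over $R[[t]]$ obtained by applying $f$ entrywise, i.e. with $(i,j)$ entry $f(t u_i v_j) = \sum_{M \geq 0} f_M u_i^M v_j^M t^M$. For an $n\times n$ matrix $A=(a_{ij})$ over a commutative ring, $\mathrm{perm}(A) := \sum_{\sigma \in S_n} a_{1\sigma(1)} \cdots a_{n\sigma(n)}$. For $\mathbf{m} = (m_1,\dots,m_n) \in \mathbb{Z}_{\geq 0}^n$, $\mathbf{v}^{\circ \mathbf{m}}$ denotes the $n \times n$ matrix $(v_j^{m_i})_{i,j=1}^n$, and similarly $\mathbf{u}^{\circ\mathbf{m}} := (u_j^{m_i})_{i,j=1}^n$ (with the convention $x^0=1$). *)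

(* Defs.v *)
From HB Require Import structures.
From mathcomp Require Import all_boot all_order all_algebra all_fingroup.
From mathcomp Require Import finmap boolp.

Set Implicit Arguments.
Unset Strict Implicit.
Unset Printing Implicit Defensive.

Import GRing.Theory.
Local Open Scope ring_scope.

(* The ring R[[t]]: [coefs f k] is the coefficient of t^k in f.
   The choice structure comes from the classical one on [nat -> R]. *)
Record fps (R : Type) := Fps { coefs : nat -> R }.

HB.instance Definition _ (R : Type) := [isNew for @coefs R].
HB.instance Definition _ (R : choiceType) := [Choice of fps R by <:].

Lemma fpsP (R : Type) (f g : fps R) : coefs f =1 coefs g <-> f = g.
Proof. by split=> [|-> //]; case: f g => [a] [b] /= /funext ->. Qed.

Section FpsRing.
Variable R : comPzRingType.
Implicit Types f g h : fps R.

Definition fps_add f g := Fps (fun k => coefs f k + coefs g k).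
Definition fps_opp f := Fps (fun k => - coefs f k).
Definition fpsC (a : R) := Fps (fun k => if k == 0%N then a else 0).
Definition fps_mul f g :=
  Fps (fun k => \sum_(i < k.+1) coefs f i * coefs g (k - i)%N).

Fact fps_addA : associative fps_add.
Proof. by move=> f g h; apply/fpsP => k /=; rewrite addrA. Qed.

Fact fps_addC : commutative fps_add.
Proof. by move=> f g; apply/fpsP => k /=; rewrite addrC. Qed.

Fact fps_add0 : left_id (fpsC 0) fps_add.
Proof. by move=> f; apply/fpsP => k /=; rewrite if_same add0r. Qed.

Fact fps_addN : left_inverse (fpsC 0) fps_opp fps_add.
Proof. by move=> f; apply/fpsP => k /=; rewrite if_same addNr. Qed.

HB.instance Definition _ :=
  GRing.isZmodule.Build (fps R) fps_addA fps_addC fps_add0 fps_addN.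

Fact coefs_mul f g k :
  coefs (fps_mul f g) k = \sum_(i < k.+1) coefs f i * coefs g (k - i)%N.
Proof. by []. Qed.

Fact coefs_mul_rev f g k :
  coefs (fps_mul f g) k = \sum_(i < k.+1) coefs f (k - i)%N * coefs g i.
Proof.
rewrite /= (reindex_inj rev_ord_inj) /=.
by apply: eq_bigr => j _; rewrite (sub_ordK j).
Qed.

Fact fps_mulC : commutative fps_mul.
Proof.
move=> f g; apply/fpsP => k; rewrite coefs_mul_rev.
by apply: eq_bigr => i _; rewrite mulrC.
Qed.

Fact fps_mulA : associative fps_mul.
Proof.
move=> p q r; apply/fpsP=> i; rewrite [LHS]coefs_mul [RHS]coefs_mul_rev.
pose coef3 j k := coefs p j * (coefs q (i - j - k)%N * coefs r k).
transitivity (\sum_(j < i.+1) \sum_(k < i.+1 | (k <= i - j)%N) coef3 j k).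
  apply: eq_bigr => j _; rewrite coefs_mul_rev big_distrr /=.
  by rewrite (big_ord_narrow_leq (leq_subr _ _)).
rewrite (exchange_big_dep predT) //=; apply: eq_bigr => k _.
transitivity (\sum_(j < i.+1 | (j <= i - k)%N) coef3 j k).
  apply: eq_bigl => j; rewrite -ltnS -(ltnS j) -!subSn ?leq_ord //.
  by rewrite -subn_gt0 -(subn_gt0 j) -!subnDA addnC.
rewrite (big_ord_narrow_leq (leq_subr _ _)) big_distrl /=.
by apply: eq_bigr => j _; rewrite /coef3 -!subnDA addnC mulrA.
Qed.

Fact fps_mul1 : left_id (fpsC 1) fps_mul.
Proof.
move=> f; apply/fpsP => k /=; rewrite big_ord_recl subn0 mul1r big1 ?addr0 //.
by move=> i _; rewrite mul0r.
Qed.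

Fact fps_mulDl : left_distributive fps_mul +%R.
Proof.
move=> f g h; apply/fpsP => k /=; rewrite -big_split.
by apply: eq_bigr => i _; rewrite mulrDl.
Qed.

HB.instance Definition _ := GRing.Zmodule_isComPzRing.Build (fps R)
  fps_mulA fps_mulC fps_mul1 fps_mulDl.

(* The indeterminate t. *)
Definition fpsX : fps R := Fps (fun k => (k == 1%N)%:R).

(* The series f(c t). *)
Definition fps_scale f (c : R) : fps R := Fps (fun k => coefs f k * c ^+ k).

(* Unconditional convergence of \sum_(i : I) F i to s for the t-adic topology:
   modulo every t^N, the finite partial sums are eventually equal to s. *)
Definition fps_has_sum (I : choiceType) (F : I -> fps R) (s : fps R) : Prop :=
  forall N : nat, exists A : {fset I}, forall B : {fset I}, (A `<=` B)%fset ->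
    forall k, (k < N)%N -> coefs (\sum_(i <- B) F i) k = coefs s k.

Lemma fps_has_sum_unique (I : choiceType) (F : I -> fps R) (s s' : fps R) :
  fps_has_sum F s -> fps_has_sum F s' -> s = s'.
Proof.
move=> Fs Fs'; apply/fpsP => k.
have [A sA] := Fs k.+1; have [B sB] := Fs' k.+1.
by rewrite -(sA (A `|` B)%fset) ?fsubsetUl // (sB (A `|` B)%fset) ?fsubsetUr.
Qed.

Lemma coefs_sum (I : Type) (r : seq I) (F : I -> fps R) k :
  coefs (\sum_(i <- r) F i) k = \sum_(i <- r) coefs (F i) k.
Proof.
by elim/big_rec2: _ => [|i x f _ <- //]; rewrite /= if_same.
Qed.

Lemma coefsCM (a : R) f k : coefs (fpsC a * f) k = a * coefs f k.
Proof.
rewrite /= big_ord_recl /= subn0 big1 ?addr0 // => i _.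
by rewrite mul0r.
Qed.

Lemma coefsXn m k : coefs (fpsX ^+ m) k = (k == m)%:R.
Proof.
elim: m k => [|m IHm] k; first by rewrite expr0 /=; case: (k == 0%N).
rewrite exprS /=; case: k => [|k].
  by rewrite big_ord1 /= mul0r.
rewrite !big_ord_recl /= mul0r add0r mul1r big1 ?addr0 => [|i _].
  by rewrite /bump /= subSS subn0 IHm.
by rewrite mul0r.
Qed.

(* [fps_scale f c] is the result of substituting c t for t in f. *)
Lemma fps_scaleE f (c : R) :
  fps_has_sum (fun M : nat => fpsC (coefs f M) * (fpsC c * fpsX) ^+ M)
    (fps_scale f c).
Proof.
have fpsCX a m : fpsC a ^+ m = fpsC (a ^+ m).
  elim: m => [|m IHm]; first by [].
  rewrite exprS IHm; apply/fpsP => k; rewrite coefsCM /= exprS.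
  by case: eqP; rewrite ?mulr0.
have cF M k : coefs (fpsC (coefs f M) * (fpsC c * fpsX) ^+ M) k
    = if k == M then coefs f k * c ^+ k else 0.
  rewrite exprMn fpsCX !coefsCM coefsXn.
  by case: eqP => [->|_]; rewrite ?mulr1 ?mulr0.
move=> N; exists [fset i in iota 0 N]%fset => B /fsubsetP sAB k ltkN.
have Bk : k \in B by apply: sAB; rewrite inE /= mem_iota.
rewrite coefs_sum (eq_bigr _ (fun i _ => cF i k)).
rewrite (bigD1_seq k) ?fset_uniq //= eqxx big1 ?addr0 // => i neq.
by rewrite eq_sym (negPf neq).
Qed.

End FpsRing.

Definition permanent (R : comPzRingType) (n : nat) (A : 'M[R]_n) : R :=
  \sum_(s : 'S_n) \prod_(i < n) A i (s i).

(* The matrix f[t A], with (i, j) entry f(t A_ij). *)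
Definition fps_entrywise (R : comPzRingType) (m n : nat) (f : fps R)
  (A : 'M[R]_(m, n)) : 'M[fps R]_(m, n) := map_mx (fps_scale f) A.

(* The matrix with (i, j) entry v_j ^ m_i; the exponents vary along rows. *)
Definition hadamard_pow (R : comPzRingType) (n : nat) (v : 'cV[R]_n)
  (m : {ffun 'I_n -> nat}) : 'M[R]_n := \matrix_(i, j) v j 0 ^+ m i.

(* Main.v *)
(* Both sides are compared in degree [k < N]: there only the finitely many
   exponent vectors with entries below [N] matter, and expanding each of the
   [n!] products of [f(t u_i v_(s i))] gives a sum over [m] of
   [prod_i f_(m_i) u_i^(m_i)] times [perm (v^m)].  The last permanent, the
   product of the [f_(m_i)] and the degree are invariant under permuting [m], so
   replacing [m] by [m o t] turns the monomial in [u] into any of the [n!]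
   monomials of [perm (u^m)] without changing the sum. *)
Require Import Defs.
From HB Require Import structures.
From mathcomp Require Import all_boot all_order all_algebra all_fingroup.
From mathcomp Require Import finmap boolp.

Set Implicit Arguments.
Unset Strict Implicit.
Unset Printing Implicit Defensive.

Import GRing.Theory.
Local Open Scope ring_scope.

Lemma fpsCM (R : comPzRingType) : {morph @fpsC R : a b / a * b}.
Proof.
move=> a b; apply/fpsP => k; rewrite coefsCM /=.
by case: eqP; rewrite ?mulr0.
Qed.

Lemma coefs_XnC (R : comPzRingType) e (a : R) k :
  coefs (fpsX R ^+ e * fpsC a) k = if e == k then a else 0.
Proof.
by rewrite mulrC coefsCM coefsXn eq_sym; case: eqP; rewrite ?mulr1 ?mulr0.
Qed.

Lemma coefs_natl (R : comPzRingType) c (f : fps R) k :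
  coefs (c%:R * f) k = c%:R * coefs f k.
Proof.
rewrite !mulr_natl; elim: c => [|c IHc]; first by rewrite /= if_same.
by rewrite !mulrS /= IHc.
Qed.

(** Congruence modulo [t^N] respects products, since a Cauchy product in degree [k] reads its
    factors only in degrees at most [k]. *)
Lemma eq_coefs_prod (R : comPzRingType) (I : Type) (r : seq I)
    (F G : I -> fps R) N :
  (forall i k, (k < N)%N -> coefs (F i) k = coefs (G i) k) ->
  forall k, (k < N)%N ->
    coefs (\prod_(i <- r) F i) k = coefs (\prod_(i <- r) G i) k.
Proof.
move=> FG; elim/big_ind2: _ => // [f f' g g' ff' gg' k ltkN|i _]; last exact: FG.
apply: eq_bigr => i _; rewrite ff' ?gg' //; apply: leq_ltn_trans ltkN.
  exact: leq_subr.
exact: leq_ord.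
Qed.

(** Degrees below [N] see only the truncations [G i] of the factors, and these are finite sums that
    distributivity can expand. *)
Lemma coefs_prod (R : comPzRingType) (I : finType) (F : I -> fps R) N k :
    (k < N)%N ->
  coefs (\prod_i F i) k =
    \sum_(m : {ffun I -> 'I_N} | (\sum_i m i)%N == k) \prod_i coefs (F i) (m i).
Proof.
move=> ltkN.
pose G i := \sum_(j < N) fpsX R ^+ j * fpsC (coefs (F i) j).
rewrite (@eq_coefs_prod _ _ _ _ G N) // => [|i {ltkN}k ltkN]; last first.
  rewrite coefs_sum (bigD1 (Ordinal ltkN)) // coefs_XnC eqxx big1 => [|j neq].
    by rewrite [RHS]addr0.
  rewrite coefs_XnC -[k]/(val (Ordinal ltkN)) val_eqE.
  by rewrite (negPf neq).
rewrite bigA_distr_bigA coefs_sum [RHS]big_mkcond; apply: eq_bigr => m _.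
rewrite big_split prodrXr -(big_morph _ (@fpsCM R) (erefl (fpsC 1))).
exact: coefs_XnC.
Qed.

Lemma permanent_row_perm (R : comPzRingType) n (t : 'S_n) (A : 'M[R]_n) :
  permanent (row_perm t A) = permanent A.
Proof.
(* With [s] replaced by [t^-1 * s] and then [i] by [t i], the factor [A i (s i)] becomes
   [A (t i) (s i)]. *)
rewrite [RHS](reindex_inj (mulgI t^-1%g)); apply: eq_bigr => s _.
rewrite [RHS](reindex_inj (@perm_inj _ t)); apply: eq_bigr => i _.
by rewrite mxE permM permK.
Qed.

Section Symmetrization.
Variables (R : comPzRingType) (n : nat) (u v : 'cV[R]_n).
Implicit Type m : {ffun 'I_n -> nat}.

Lemma hadamard_pow_comp m (t : 'S_n) :
  hadamard_pow v [ffun i => m (t i)] = row_perm t (hadamard_pow v m).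
Proof. by apply/matrixP => i j; rewrite !mxE ffunE. Qed.

Lemma sum_permanent_hadamard_pow (a : nat -> R) N k :
  let m_ (m : {ffun 'I_n -> 'I_N}) := [ffun i => val (m i)] in
  \sum_(m : {ffun 'I_n -> 'I_N} | (\sum_i m i)%N == k)
     permanent (hadamard_pow u (m_ m)) * permanent (hadamard_pow v (m_ m))
       * \prod_i a (m i) =
  n`!%:R * \sum_(m : {ffun 'I_n -> 'I_N} | (\sum_i m i)%N == k)
     (\prod_i u i 0 ^+ m i) * permanent (hadamard_pow v (m_ m))
       * \prod_i a (m i).
Proof.
(* The [n!] copies on the right are indexed by ['S_n], to be matched one by one with the terms of
   the permanent in [u]. *)
move=> m_; rewrite mulr_natl -card_Sn -sumr_const.
under eq_bigr do rewrite -mulrA mulr_suml.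
rewrite exchange_big; apply: eq_big => [t|t _]; first by rewrite inE.
pose comp (s : 'S_n) (m : {ffun 'I_n -> 'I_N}) := [ffun i => m (s i)].
have compK : cancel (comp t) (comp t^-1%g).
  by move=> m; apply/ffunP => i; rewrite !ffunE permKV.
rewrite (reindex_inj (can_inj compK)); apply: eq_big => m.
  rewrite [in RHS](reindex_inj (@perm_inj _ t)).
  by under eq_bigr do rewrite ffunE.
move=> _; have -> : m_ (comp t m) = [ffun i => m_ m (t i)].
  by apply/ffunP => i; rewrite !ffunE.
rewrite hadamard_pow_comp permanent_row_perm mulrA; congr (_ * _ * _).
  (* The monomial selected by [t] now has factors [u_(t i)^(m_(t i))], which are those on the right
     in another order. *)
  rewrite [RHS](reindex_inj (@perm_inj _ t)); apply: eq_bigr => i _.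
  by rewrite mxE !ffunE.
rewrite [RHS](reindex_inj (@perm_inj _ t)); apply: eq_bigr => i _.
by rewrite ffunE.
Qed.

Lemma coefs_permanent_fps_entrywise (f : fps R) N k : (k < N)%N ->
  coefs (permanent (fps_entrywise f (u *m v^T))) k =
  \sum_(m : {ffun 'I_n -> 'I_N} | (\sum_i m i)%N == k)
     (\prod_i u i 0 ^+ m i) *
     permanent (hadamard_pow v [ffun i => val (m i)]) *
     \prod_i coefs f (m i).
Proof.
move=> ltkN; rewrite coefs_sum.
under eq_bigr do rewrite (coefs_prod _ ltkN).
(* For fixed [m], only the product of the [v_(s i)^(m_i)] depends on [s]; its sum over [s] is the
   permanent. *)
rewrite exchange_big; apply: eq_bigr => m _.
rewrite mulr_sumr mulr_suml; apply: eq_bigr => s _.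
rewrite -!big_split; apply: eq_bigr => i _ /=.
by rewrite !mxE big_ord1 !mxE ffunE /= exprMn mulrC.
Qed.

End Symmetrization.

Theorem theorem1p3 (R : comPzRingType) (f : fps R) (n : nat) (hn : (1 <= n)%N)
    (u v : 'cV[R]_n) :
  fps_has_sum
    (fun m : {ffun 'I_n -> nat} =>
       fpsX R ^+ (\sum_(i < n) m i)%N *
       fpsC (permanent (hadamard_pow u m) * permanent (hadamard_pow v m) *
             \prod_(i < n) coefs f (m i)))
    (n`!%:R * permanent (fps_entrywise f (u *m v^T))).
Proof.
move=> N.
pose m_ (m : {ffun 'I_n -> 'I_N}) : {ffun 'I_n -> nat} := [ffun i => val (m i)].
have m_inj : injective m_.
  move=> m m' /ffunP eqm; apply/ffunP => i.
  by apply/val_inj; have := eqm i; rewrite !ffunE.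
exists [fset m_ m | m in {: {ffun 'I_n -> 'I_N}}]%fset => B sAB k ltkN.
rewrite coefs_natl (coefs_permanent_fps_entrywise _ _ _ ltkN).
rewrite -sum_permanent_hadamard_pow coefs_sum.
under eq_bigr do rewrite coefs_XnC.
(* A vector of total degree [k < N] has all entries below [N], so those in [B] outside the witness
   contribute 0 in degree [k]. *)
rewrite -(big_fset_incl _ sAB) => [|m _ mA] /=; last first.
  case: eqP => // degm; case/imfsetP: mA.
  have ltmN i : (m i < N)%N.
    by apply: leq_ltn_trans ltkN; rewrite -degm (bigD1 i) //= leq_addr.
  exists [ffun i => Ordinal (ltmN i)] => //.
  by apply/ffunP => i; rewrite !ffunE.
rewrite big_imfset /=; last by move=> m m' _ _ /m_inj.
rewrite big_enum [RHS]big_mkcond /=; apply: eq_bigr => m _.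
under eq_bigr do rewrite ffunE.
by under [\prod_(i < n) _]eq_bigr do rewrite ffunE.
Qed.
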